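(* A finite group is inherently nondualisable if it contains a nonabelian Sylow subgroup.
   Context: Groups are regarded as algebras in the usual group signature. Duality notions. Let $\mathbf{M}$ be a finite algebra and $\mathcal{Q}=\mathsf{ISP}(\mathbf{M})$ the quasivariety it generates (isomorphic copies of subalgebras of direct powers of $\mathbf{M}$). An alter ego $\mathbb{M}$ of $\mathbf{M}$ is a structure on the same universe $M$, carrying the discrete topology and some finitary operations, partial operations and relations, such that each $n$-ary operation is a homomorphism $\mathbf{M}^n\to\mathbf{M}$, each $n$-ary relation is a subalgebra of $\mathbf{M}^n$, and each $n$-ary partial operation is a homomorphism from a subalgebra of $\mathbf{M}^n$ into $\mathbf{M}$. Let $\mathcal{X}=\mathsf{IS_cP^+}(\mathbb{M})$ be the class of topologically and algebraically isomorphic copies of closed substructures of powers of $\mathbb{M}$ over nonempty index sets (product topology, pointwise structure). For $\mathbf{A}\in\mathcal{Q}$, $D(\mathbf{A})=\hom(\mathbf{A},\mathbf{M})$, a closed substructure of $\mathbb{M}^A$; for $\mathbb{A}\in\mathcal{X}$, $E(\mathbb{A})$ is the algebra of continuous homomorphisms (structure-preserving maps) $\mathbb{A}\to\mathbb{M}$, a subalgebra of $\mathbf{M}^{\mathbb{A}}$. $\mathbb{M}$ yields a duality on $\mathbf{A}$ if the (always injective) evaluation homomorphism $e:\mathbf{A}\to E(D(\mathbf{A}))$, $e_a(x)=x(a)$, is an isomorphism. $\mathbf{M}$ is dualisable (admits a natural duality) if some alter ego of $\mathbf{M}$ yields a duality on every $\mathbf{A}\in\mathcal{Q}$; otherwise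 it is nondualisable. A finite algebra $\mathbf{M}$ is inherently nondualisable if $\mathbf{M}\notin\mathsf{ISP}(\mathbf{N})$ for every finite dualisable algebra $\mathbf{N}$. *)

(* Defs.v *)
Set Warnings "-notation-overridden,-notation-incompatible-prefix".
From HB Require Import structures.
From mathcomp Require Import all_boot all_fingroup all_solvable.
From mathcomp Require Import all_classical topology function_spaces.

Set Implicit Arguments.
Unset Strict Implicit.
Unset Printing Implicit Defensive.

Local Open Scope classical_set_scope.

(** * Algebras *)

Record signature := Signature { symbol : Type; arity : symbol -> nat }.

Record algebra (S : signature) := Algebra {
  carrier :> Type;
  op : forall f : symbol S, ('I_(arity f) -> carrier) -> carrier }.

Section Algebras.
Context {S : signature}.
Implicit Types M A B : algebra S.

Definition is_hom A B (h : A -> B) : Prop :=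
  forall (f : symbol S) (xs : 'I_(arity f) -> A), h (op xs) = op (h \o xs).

Definition is_iso A B (h : A -> B) : Prop := is_hom h /\ bijective h.

Definition isomorphic A B : Prop := exists h : A -> B, is_iso h.

Definition power M (I : Type) : algebra S :=
  @Algebra S (I -> M) (fun f xs i => op (fun k => xs k i)).

Definition subuniverse A (B : set A) : Prop :=
  forall (f : symbol S) (xs : 'I_(arity f) -> A),
    (forall k, B (xs k)) -> B (op xs).

Definition subalgebra A (B : set A) (HB : subuniverse B) : algebra S :=
  @Algebra S (set_type B) (fun f xs =>
    SigSub (mem_set (HB f (fun k => val (xs k)) (fun k => set_valP (xs k))))).

(* The index set [I] may be empty, so ISP contains the one-element algebras. *)
Definition ISP M A : Prop :=
  exists (I : Type) (B : set (power M I)) (HB : subuniverse B),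
    isomorphic A (subalgebra HB).

Definition finite_algebra A : Prop := finite_set [set: A].

End Algebras.

(** * Topological structures *)

Record struct_signature := StructSignature {
  osym : Type; op_arity : osym -> nat;
  psym : Type; pop_arity : psym -> nat;
  rsym : Type; rel_arity : rsym -> nat }.

(* The partial operation [h] is the map [spop] from its domain [sdom h]; the
   arities may be zero. *)
Record structure (T : struct_signature) := Structure {
  scarrier :> topologicalType;
  sop : forall o : osym T, ('I_(op_arity o) -> scarrier) -> scarrier;
  sdom : forall h : psym T, set ('I_(pop_arity h) -> scarrier);
  spop : forall h : psym T, set_type (@sdom h) -> scarrier;
  srel : forall r : rsym T, set ('I_(rel_arity r) -> scarrier) }.

Section Structures.
Context {T : struct_signature}.
Implicit Types X Y : structure T.

Definition is_shom X Y (f : X -> Y) : Prop :=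
  [/\ forall o (xs : 'I_(op_arity o) -> X), f (sop xs) = sop (f \o xs),
      forall h (xs : set_type (@sdom T X h)),
        exists2 ys : set_type (@sdom T Y h),
          val ys = f \o val xs & f (spop xs) = spop ys
    & forall r (xs : 'I_(rel_arity r) -> X), srel xs -> srel (f \o xs)].

(* [{ptws I -> X}] carries the product topology. *)
Definition spower_dom X (I : Type) (h : psym T) :
    set ('I_(pop_arity h) -> {ptws I -> X}) :=
  [set xs | forall i, @sdom T X h (fun k => xs k i)].

Definition spower X (I : Type) : structure T :=
  @Structure T {ptws I -> X}
    (fun o xs i => sop (fun k => xs k i))
    (@spower_dom X I)
    (fun h xs i => spop (SigSub (mem_set (set_valP xs i))))
    (fun r => [set xs | forall i, srel (fun k => xs k i)]).

Definition substructure_closed X (B : set X) : Prop :=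
  (forall o (xs : 'I_(op_arity o) -> X), (forall k, B (xs k)) -> B (sop xs)) /\
  (forall h (xs : set_type (@sdom T X h)),
     (forall k, B (val xs k)) -> B (spop xs)).

Definition sub_dom X (B : set X) (h : psym T) :
    set ('I_(pop_arity h) -> set_type B) :=
  [set xs | @sdom T X h (fun k => val (xs k))].

(* [set_type B] carries the subspace topology. *)
Definition substructure X (B : set X) (HB : substructure_closed B) :
    structure T :=
  @Structure T (set_type B)
    (fun o xs => SigSub (mem_set
       (HB.1 o (fun k => val (xs k)) (fun k => set_valP (xs k)))))
    (@sub_dom X B)
    (fun h xs => SigSub (mem_set
       (HB.2 h (SigSub (mem_set (set_valP xs : sdom _)))
          (fun k => set_valP (val xs k)))))
    (fun r => [set xs | srel (fun k => val (xs k))]).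

End Structures.

(** * Alter egos and natural dualities *)

Record alter_ego (S : signature) (M : algebra S) := AlterEgo {
  ego_sig : struct_signature;
  ego_op : forall o : osym ego_sig, ('I_(op_arity o) -> M) -> M;
  ego_dom : forall h : psym ego_sig, set ('I_(pop_arity h) -> M);
  ego_pop : forall h : psym ego_sig, set_type (@ego_dom h) -> M;
  ego_rel : forall r : rsym ego_sig, set ('I_(rel_arity r) -> M);
  ego_op_hom : forall o, is_hom (@ego_op o : power M _ -> M);
  ego_dom_sub : forall h, @subuniverse S (power M _) (@ego_dom h);
  ego_pop_hom : forall h,
    is_hom (@ego_pop h : subalgebra (@ego_dom_sub h) -> M);
  ego_rel_sub : forall r, @subuniverse S (power M _) (@ego_rel r) }.

Section Duality.
Context {S : signature} {M : algebra S}.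
Variable ego : alter_ego M.
Local Notation T := (ego_sig ego).

Definition ego_structure : structure T :=
  @Structure T (discrete_topology {classic M})
    (@ego_op S M ego) (@ego_dom S M ego) (@ego_pop S M ego)
    (@ego_rel S M ego).

Lemma hom_closed (A : algebra S) :
  @substructure_closed T (spower ego_structure A)
    [set x | @is_hom S A M x].
Proof.
split=> [o xs hxs f as_|h xs hxs f as_] /=.
  rewrite -[RHS](@ego_op_hom S M ego o f (fun j k => xs k (as_ j))) /=.
  congr ego_op.
  by apply/funext => k /=; rewrite (hxs k).
set u := fun j => SigSub (mem_set (set_valP xs (as_ j))) :
  subalgebra (@ego_dom_sub S M ego h).
have := @ego_pop_hom S M ego h f u; rewrite /u /comp /= => <-.
congr ego_pop; apply: val_inj => /=.
by apply/funext => k /=; rewrite (hxs k).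
Qed.

Definition D (A : algebra S) : structure T := substructure (@hom_closed A).

Lemma E_subuniverse (X : structure T) :
  @subuniverse S (power M X)
    [set f | continuous (f : X -> ego_structure) /\
             is_shom (f : X -> ego_structure)].
Proof.
move=> f xs hxs; split=> [x|].
  have H : \forall y \near x, forall k, xs k y = xs k x.
    by apply: filter_forall => k; have /= := (hxs k).1 x [set xs k x];
      apply; apply/principal_filterP.
  move=> B /principal_filterP Bx.
  apply: (@filterS _ (nbhs x) _ _ _ _ H) => y Hy.
  rewrite /preimage /= (_ : (fun k => xs k y) = (fun k => xs k x)) //.
  exact/funext.
split=> [o ys|h ys|r ys hr] /=.
- rewrite [RHS](@ego_op_hom S M ego o f (fun k i => xs k (ys i))) /=.
  by congr op; apply/funext => k; have [-> _ _] := (hxs k).2.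
- have H k := (let: And3 _ H _ := (hxs k).2 in H) h ys.
  pose u k : subalgebra (@ego_dom_sub S M ego h) := sval (cid2 (H k)).
  have u1 k : val (u k) = xs k \o val ys by rewrite /u; case: cid2.
  have u2 k : xs k (spop ys) = ego_pop (u k) by rewrite /u; case: cid2.
  exists (op u).
    by apply/funext => i /=; congr op; apply/funext => k; rewrite u1.
  by rewrite /= (ego_pop_hom u); congr op; apply/funext => k /=; rewrite u2.
- apply: (@ego_rel_sub S M ego r f (fun k i => xs k (ys i))) => k.
  by have [_ _ /(_ r ys hr)] := (hxs k).2.
Qed.

(* The continuous homomorphisms from [X] to the alter ego, as a subalgebra of
   the power of [M] indexed by the points of [X] *)
Definition E (X : structure T) : algebra S := subalgebra (@E_subuniverse X).

Lemma evaluation_in_E (A : algebra S) (a : A) :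
  [set f : D A -> M | continuous (f : D A -> ego_structure) /\
                      is_shom (f : D A -> ego_structure)]
    (fun x => val x a).
Proof.
split.
  move=> x.
  apply: (@continuous_comp _ _ _ (set_val : D A -> spower ego_structure A)
    (fun g => g a)).
    exact: initial_continuous.
  exact: (@proj_continuous {classic A} (fun=> ego_structure) a).
split=> [o xs //|h xs|r xs hr /=]; last exact: hr.
exists (SigSub (mem_set (set_valP xs a))) => //=.
by congr ego_pop; apply: val_inj.
Qed.

Definition evaluation (A : algebra S) (a : A) : E (D A) :=
  SigSub (mem_set (@evaluation_in_E A a)).

Definition yields_duality_on (A : algebra S) : Prop := is_iso (@evaluation A).

End Duality.

Definition dualisable (S : signature) (M : algebra S) : Prop :=
  exists ego : alter_ego M, forall A : algebra S, ISP M A ->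
    yields_duality_on ego A.

(* [N] ranges over all finite algebras of the signature of [M]: for a group [M],
   it need not be a group. *)
Definition inherently_nondualisable (S : signature) (M : algebra S) : Prop :=
  finite_algebra M /\
  forall N : algebra S, finite_algebra N -> dualisable N -> ~ ISP N M.

(** * Groups as algebras *)

Inductive group_symbol := GMul | GInv | GOne.

Definition group_arity (f : group_symbol) : nat :=
  match f with GMul => 2 | GInv => 1 | GOne => 0 end.

Definition group_signature : signature := Signature group_arity.

Definition group_op (gT : finGroupType) (f : group_symbol) :
    ('I_(group_arity f) -> gT) -> gT :=
  match f with
  | GMul => fun xs => (xs ord0 * xs ord_max)%g
  | GInv => fun xs => (xs ord0)^-1%g
  | GOne => fun=> 1%g
  end.

Definition group_algebra (gT : finGroupType) : algebra group_signature :=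
  @Algebra group_signature gT (@group_op gT).

(* Main.v *)
(** Let [c = [~ a, b] <> 1] commute with [a] and [b]; such a pair is found in a
    nonabelian Sylow subgroup, just above the bottom of its lower central
    series.  Inside the power of the group indexed by [nat * nat], consider the
    subalgebra of words [b ^ w * a ^ v * c ^ t], with [w i j = r i + s j] and
    [r], [s], [v], [t] finitely supported, where, modulo the group order, [v] has zero
    row and column sums and [t] has zero total sum; the sum conditions survive
    multiplication because reordering contributes [v * w], of total sum zero.

    Write [d i j] for [c] at [(0, 0)] times [c^-1] at [(i, j)].  Let [x] be a
    homomorphism to an algebra with [k] elements.  If [x] identifies the
    elements [b] on row [i] and [b] on row [i'], then it identifies their
    commutators with a rectangular [a]-pattern meeting row [i] but not row [i'];
    hence [x (d i j)] does not depend on [j].  So all but at most [k] rows are constant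
    for [x], and in the same way some column is, whence [x (d i 0)] takes a
    single value outside at most [k] indices [i].  This limit value, as a function of
    [x], is locally an evaluation at some [d i 0], so it is a continuous
    structure-preserving map for every alter ego.  A duality would make it the
    evaluation at an element of the subalgebra, namely the pointwise limit: [c]
    at [(0, 0)] and [1] elsewhere, which violates the sum condition. *)

Require Import Defs.
Set Warnings "-notation-overridden,-notation-incompatible-prefix".
From mathcomp Require Import all_boot all_fingroup all_solvable.
From mathcomp Require Import all_classical topology function_spaces.

Set Implicit Arguments.
Unset Strict Implicit.
Unset Printing Implicit Defensive.

(** * Membership in ISP through embeddings into powers *)

Lemma ISP_of_injective_hom (S : signature) (M A : algebra S) (I : Type)
    (h : A -> power M I) :
  is_hom h -> injective h -> ISP M A.
Proof.
move=> hhom hinj.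
have Hr : @subuniverse S (power M I) (range h).
  move=> f xs xsr.
  have /choice[ys ysE] : forall k, exists y, h y = xs k.
    by move=> k; have [y _ <-] := xsr k; exists y.
  exists (op ys) => //; rewrite hhom; congr op; exact/funext.
exists I, (range h), Hr.
pose g (y : A) : subalgebra Hr := SigSub (mem_set (imageT h y)).
exists g; split=> [f xs|]; first by apply: val_inj; rewrite /= hhom.
have /choice[g' g'E] : forall z : subalgebra Hr, exists y, g y = z.
  move=> z; have [y _ yE] := set_valP z; exists y; exact: val_inj.
exists g' => // y; apply: hinj.
by have /(congr1 val) := g'E (g y).
Qed.

Lemma ISP_injective_hom (S : signature) (M A : algebra S) : ISP M A ->
  exists (I : Type) (h : A -> power M I), is_hom h /\ injective h.
Proof.
move=> [I [B [HB [h [hhom hbij]]]]]; exists I, (fun y => val (h y)); split.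
  by move=> f xs; rewrite hhom.
by move=> y y' /val_inj; exact: bij_inj.
Qed.

Lemma ISP_subalgebra_power (S : signature) (N M : algebra S) (J : Type)
    (B : set (power M J)) (HB : subuniverse B) :
  ISP N M -> ISP N (subalgebra HB).
Proof.
move=> /ISP_injective_hom[I [h [hhom hinj]]].
pose hJ (y : subalgebra HB) : power N (J * I) := fun ji => h (val y ji.1) ji.2.
apply: (@ISP_of_injective_hom _ _ _ _ hJ).
  by move=> f xs; apply/funext => -[j i]; rewrite /hJ /= (hhom f).
move=> y y' /funeqP yy'; apply: val_inj; apply/funext => j; apply: hinj.
by apply/funext => i; exact: yy' (j, i).
Qed.

Lemma finite_algebra_injection (S : signature) (N : algebra S) :
  finite_algebra N -> exists k (f : N -> 'I_k), injective f.
Proof.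
move=> [k /card_set_bijP [f [fto finj _]]].
exists k, (fun y => Ordinal (fto y I)) => y y' [] /finj; apply; exact: in_setT.
Qed.

(** * Limits of evaluations with a uniform bound on the exceptions *)

Section LocalLimit.
Variables (S : signature) (N : algebra S) (ego : alter_ego N).
Local Notation Y := (ego_structure ego).
Variables (X : structure (ego_sig ego)) (ev : nat -> X -> Y) (k : nat).
Variable e : X -> Y.
Hypothesis ev_cont : forall i, continuous (ev i).
Hypothesis ev_shom : forall i, is_shom (ev i).
Hypothesis e_bound : forall x n,
  #|[set i : 'I_n | `[< ev i x <> e x >]]| <= k.

(** Each point of the finite family rules out at most [k] indices, so among [#|J| * k + 1] of them
    one survives for all points at once. *)
Lemma limit_eq_ev (J : finType) (xs : J -> X) :
  exists2 i, i < (#|J| * k).+1 & forall j, e (xs j) = ev i (xs j).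
Proof.
set n := _.+1; apply: contrapT => bad.
have : n <= \sum_(j : J) k.
  pose bad_at j := [set i : 'I_n | `[< ev i (xs j) <> e (xs j) >]].
  apply: (@leq_trans (\sum_j #|bad_at j|)); last first.
    by apply: leq_sum => j _; exact: e_bound.
  under eq_bigr do rewrite /bad_at -sum1_card big_mkcond.
  rewrite exchange_big /= -[leqLHS]card_ord -sum1_card leq_sum // => i _.
  rewrite lt0n sum_nat_eq0; apply/negP => /forallP z.
  apply: bad; exists i => // j; have := z j; rewrite /bad_at inE.
  by case: asboolP => // /contrapT ->.
by rewrite sum_nat_const ltnn.
Qed.

Lemma limit_continuous : continuous e.
Proof.
move=> x B /principal_filterP Bx.
(* The index serving both [x] and [y] depends on [y] but stays below [2 * k + 1], so constancy near
   [x] is secured for all these evaluations beforehand. *)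
have near_ev : \forall y \near x,
    forall i : 'I_(#|{: bool}| * k).+1, ev i y = ev i x.
  apply: filter_forall => i.
  have /= := @ev_cont i x [set ev i x]%classic.
  by apply; apply/principal_filterP.
apply: (@filterS _ (nbhs x) _ _ _ _ near_ev) => y xy.
have [i ltin ei] := limit_eq_ev (fun j : bool => if j then x else y).
by rewrite /preimage /= (ei false) (xy (Ordinal ltin)) -(ei true).
Qed.

Lemma limit_is_shom : is_shom e.
Proof.
split=> [o xs|h xs|r xs hr].
(* The result of the operation joins its arguments in the family, as the value at [None]. *)
- have [i _ ei] := limit_eq_ev (oapp xs (Defs.sop xs)).
  rewrite (ei None); have [-> _ _] := ev_shom i; congr Defs.sop.
  by apply/funext => j; rewrite /= (ei (Some j)).
- have [i _ ei] := limit_eq_ev (oapp (val xs) (spop xs)).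
  have -> : e \o val xs = ev i \o val xs.
    by apply/funext => j; exact: ei (Some j).
  by rewrite (ei None); have [_ + _] := ev_shom i; apply.
- have [i _ ei] := limit_eq_ev xs.
  have -> : e \o xs = ev i \o xs by exact/funext.
  by have [_ _] := ev_shom i; apply.
Qed.

End LocalLimit.

(** As [k] does not depend on [x], the limit is continuous and structure-preserving; surjectivity of
    the evaluation map then realises it by an element of [A]. *)
Lemma duality_limit (S : signature) (N : algebra S) (ego : alter_ego N)
    (A : algebra S) (d : nat -> A) (k : nat) :
  yields_duality_on ego A ->
  (forall x : A -> N, is_hom x ->
    exists q, forall n, #|[set i : 'I_n | `[< x (d i) <> q >]]| <= k) ->
  exists a : A, forall x : A -> N, is_hom x ->
    forall n, #|[set i : 'I_n | `[< x (d i) <> x a >]]| <= k.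
Proof.
move=> [_ [ev' _ evK]] lim.
have /choice[e eP] : forall x : D ego A, exists q : ego_structure ego,
    forall n, #|[set i : 'I_n | `[< val x (d i) <> q >]]| <= k.
  by move=> x; exact: lim (set_valP x).
have ev_in i := evaluation_in_E ego (d i).
have eE : continuous e /\ is_shom e.
  split; first exact: limit_continuous (fun i => (ev_in i).1) eP.
  exact: limit_is_shom (fun i => (ev_in i).2) eP.
pose eelt : E (D ego A) := SigSub (mem_set eE).
exists (ev' eelt) => x xhom n.
have eE' : e (SigSub (mem_set xhom)) = x (ev' eelt).
  by rewrite -[e]/(val eelt) -{1}(evK eelt).
by have := eP (SigSub (mem_set xhom)) n; rewrite eE'.
Qed.

(** * Central commutators in nilpotent groups *)

Lemma nilpotent_nonabelian_central_commutator (gT : finGroupType)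
    (P : {group gT}) :
  nilpotent P -> ~~ abelian P ->
  exists a b, [/\ a \in P, b \in P, [~ a, b]%g != 1%g,
    commute a [~ a, b]%g & commute b [~ a, b]%g].
Proof.
move=> /lcnP[n0 Ln0] ncP.
have exL : exists n, 'L_n.+1(P)%g == 1%g by exists n0; apply/eqP.
(* A least index below 2 would make [P] abelian. Otherwise the last nontrivial term is centralised
   by [P] and generated by commutators, one of which is nontrivial. *)
case: (ex_minnP exL) => -[|[|n]] /eqP Ln minn.
- by move: ncP; rewrite -[P : {set _}]lcn1 Ln abelian1.
- move: ncP; rewrite /abelian (sameP commG1P eqP).
  by rewrite -{1}(lcn1 P) -lcnSn Ln eqxx.
have /commG1P Lcent : [~: 'L_n.+2(P), P]%g = 1%g by rewrite -lcnSn Ln.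
have : 'L_n.+2(P)%g != 1%g by apply/negP => /minn; rewrite ltnn.
rewrite lcnSn -(sameP commG1P eqP) => /subsetPn[a La /centP].
rewrite -existsNE => -[b]; rewrite not_implyE => -[Pb cab].
have Pa : a \in P by apply: fintype.subsetP La; exact: lcn_sub.
have Lab : [~ a, b]%g \in 'L_n.+2(P)%g by rewrite lcnSn mem_commg.
exists a, b; split=> //; first by apply/negP => /commgP.
- by apply: commute_sym; exact: (centP (fintype.subsetP Lcent _ Lab)).
- by apply: commute_sym; exact: (centP (fintype.subsetP Lcent _ Lab)).
Qed.

(** * Group terms in an algebra that need not satisfy the group laws *)

Definition gmul (A : algebra group_signature) (p q : A) : A :=
  @op group_signature A GMul (fun k => if val k == 0 then p else q).

Definition ginv (A : algebra group_signature) (p : A) : A :=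
  @op group_signature A GInv (fun=> p).

Lemma hom_gmul (A B : algebra group_signature) (x : A -> B) : is_hom x ->
  {morph x : p q / gmul p q}.
Proof.
move=> xhom p q; rewrite /gmul xhom; congr op.
by apply/funext => k /=; case: ifP.
Qed.

Lemma hom_ginv (A B : algebra group_signature) (x : A -> B) : is_hom x ->
  {morph x : p / ginv p}.
Proof. by move=> xhom p; rewrite /ginv xhom. Qed.

(** * The subalgebra of balanced words on the grid *)

Section Grid.
Variables (gT : finGroupType) (a b : gT).
Local Notation c := [~ a, b]%g.
Local Notation m := #|gT|.
Hypotheses (cac : commute a c) (cbc : commute b c).

(* Exponents are naturals read modulo the order of the group. *)
Definition balanced (r s : nat -> nat) (v t : nat -> nat -> nat) (n : nat) :=
  [/\ r n = 0 /\ s n = 0,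
      forall i, [/\ v i n = 0, v n i = 0, t i n = 0 & t n i = 0],
      forall i, m %| \sum_(j < n) v i j,
      forall j, m %| \sum_(i < n) v i j
    & m %| \sum_(i < n) \sum_(j < n) t i j].

Definition grid_word r s v t (z : nat * nat) : gT :=
  (b ^+ (r z.1 + s z.2) * a ^+ v z.1 z.2 * c ^+ t z.1 z.2)%g.

(** Asking for [balanced] at every [n'] past [n] encodes finite support: rows and columns from [n]
    on vanish, and the truncated sums are the full ones. *)
Definition grid_set : set (power (group_algebra gT) (nat * nat)) :=
  [set x | exists n r s v t,
    (forall n', n <= n' -> balanced r s v t n') /\ x = grid_word r s v t].

Lemma card_prednK : m.-1.+1 = m.
Proof. by rewrite prednK //; apply/card_gt0P; exists 1%g. Qed.

Lemma expg_dvd_card (x : gT) n : m %| n -> (x ^+ n = 1)%g.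
Proof.
move=> mn; apply/eqP; rewrite -order_dvdn; apply: dvdn_trans mn.
by rewrite -cardsT; apply: order_dvdG; rewrite inE.
Qed.

(** Moving [a ^+ p] past [b ^+ w'] creates the factor [c ^+ (p * w')]. *)
Lemma commutator_word_mul w p q w' p' q' :
  (b ^+ w * a ^+ p * c ^+ q * (b ^+ w' * a ^+ p' * c ^+ q') =
   b ^+ (w + w') * a ^+ (p + p') * c ^+ (q + q' + p * w'))%g.
Proof.
have cqb : commute (c ^+ q)%g (b ^+ w')%g by exact: commuteX2 (commute_sym cbc).
have cqa : commute (c ^+ (q + p * w'))%g (a ^+ p')%g.
  exact: commuteX2 (commute_sym cac).
rewrite addnAC (expgD c) (expgD a) -!mulgA.
rewrite [(a ^+ p' * (_ * _))%g]mulgA -cqa !mulgA.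
congr (_ * _ * _)%g; rewrite -!mulgA cqb.
rewrite [(a ^+ p * (_ * _))%g]mulgA (commgC (a ^+ p)%g) commXXg //.
by rewrite (addnC q) !expgD -!mulgA.
Qed.

Lemma grid_mul x y : grid_set x -> grid_set y ->
  grid_set (fun z => x z * y z)%g.
Proof.
move=> [n [r [s [v [t [bal ->]]]]]] [n' [r' [s' [v' [t' [bal' ->]]]]]].
exists (maxn n n'), (fun i => r i + r' i), (fun i => s i + s' i),
  (fun i j => v i j + v' i j),
  (fun i j => t i j + t' i j + v i j * (r' i + s' j)); split=> [k|].
  rewrite geq_max => /andP[/bal[[r0 s0] v0 rowv colv sumt]].
  move=> /bal'[[r'0 s'0] v'0 rowv' colv' sumt']; split=> //.
  - by rewrite r0 s0 r'0 s'0.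
  - by move=> i; have [-> -> -> ->] := v0 i; have [-> -> -> ->] := v'0 i.
  - by move=> i; rewrite big_split dvdn_add.
  - by move=> i; rewrite big_split dvdn_add.
  - under eq_bigr do rewrite !big_split; rewrite !big_split /=.
    rewrite !dvdn_add //.
    (* In the cross term, [r'] is constant along rows and [s'] along columns, so the row and column
       sums of [v] factor out. *)
    under eq_bigr do (under eq_bigr do rewrite mulnDr; rewrite big_split).
    rewrite big_split /= dvdn_add //; last rewrite exchange_big /=.
      by apply: dvdn_sum => i _; rewrite -big_distrl /= dvdn_mulr.
    by apply: dvdn_sum => i _; rewrite -big_distrl /= dvdn_mulr.
apply/funext => -[i j]; rewrite /grid_word /=.
by rewrite commutator_word_mul addnACA.
Qed.

Lemma grid_one : grid_set (fun=> 1%g).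
Proof.
exists 0, (fun=> 0), (fun=> 0), (fun _ _ => 0), (fun _ _ => 0).
split=> [n _|]; last by apply/funext => z; rewrite /grid_word !mulg1.
by split=> // *; rewrite !big1 //= => *; rewrite big1.
Qed.

Lemma grid_exp x k : grid_set x -> grid_set (fun z => x z ^+ k)%g.
Proof.
move=> gx; elim: k => [|k IHk]; first exact: grid_one.
have := grid_mul gx IHk; congr grid_set.
by apply/funext => z; rewrite expgS.
Qed.

Lemma grid_inv x : grid_set x -> grid_set (fun z => (x z)^-1)%g.
Proof.
(* Inverses are [m.-1]-th powers, which keeps all exponents natural. *)
move=> /(grid_exp m.-1); congr grid_set; apply/funext => z.
apply/eqP; rewrite eq_sym eq_invg_mul -expgS card_prednK.
by rewrite expg_dvd_card.
Qed.

Lemma grid_subuniverse : subuniverse grid_set.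
Proof.
case=> /= xs gxs; first exact: grid_mul.
- exact: grid_inv.
- exact: grid_one.
Qed.

(** Far out on row [i] only [b ^+ r i] survives, so it is 1, and likewise for columns. Multiplying
    the remaining powers of [a] and [c] over the grid then gives [c] on one side and, by the sum
    conditions, 1 on the other. *)
Lemma grid_no_point (g : nat * nat -> gT) :
  (forall z, g z = if z == (0, 0) then c else 1%g) -> grid_set g -> c = 1%g.
Proof.
move=> gE [n [r [s [v [t [bal gW]]]]]].
have wE z : grid_word r s v t z = if z == (0, 0) then c else 1%g.
  by rewrite -gW gE.
(* The cutoff [n.+1], unlike [n], is surely nonzero, so row and column [n.+1] miss [(0, 0)]. *)
have [[r0 s0] v0 rowv _ sumt] := bal n.+1 (leqnSn n).
have br i : (b ^+ r i = 1)%g.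
  have := wE (i, n.+1); rewrite xpair_eqE andbF /grid_word /= s0 addn0.
  by have [-> _ -> _] := v0 i; rewrite !mulg1.
have bs j : (b ^+ s j = 1)%g.
  have := wE (n.+1, j); rewrite xpair_eqE /grid_word /= r0.
  by have [_ -> _ ->] := v0 j; rewrite !mulg1.
have acE i j : (a ^+ v i j * c ^+ t i j = c ^+ ((i == 0) && (j == 0)))%g.
  have := wE (i, j); rewrite /grid_word /= expgD br bs !mul1g xpair_eqE => ->.
  by case: ifP.
have sumE (F G H : nat -> nat) :
    (forall i, a ^+ F i * c ^+ G i = c ^+ H i)%g ->
    (a ^+ (\sum_(i < n.+1) F i) * c ^+ (\sum_(i < n.+1) G i) =
     c ^+ (\sum_(i < n.+1) H i))%g.
  move=> FGH; elim/big_rec3: _ => [|i x y z _ IH]; first by rewrite mulg1.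
  rewrite [in RHS]expgD -IH -FGH !expgD -!mulgA; congr (_ * _)%g.
  by rewrite !mulgA; congr (_ * _)%g; exact: commuteX2.
have := sumE _ _ _ (fun i => sumE _ _ _ (acE i)).
rewrite (expg_dvd_card _ sumt) expg_dvd_card ?dvdn_sum // mulg1.
rewrite big_ord_recl big_ord_recl /=.
by rewrite !big1 //= => i _; rewrite big1.
Qed.

(** * Rows, columns, rectangles and differences in the grid algebra *)

Definition grid_algebra := subalgebra grid_subuniverse.

(* The weight [m.-1] stands for [-1]. *)
Definition dipole (i i' k : nat) : nat := (k == i) + (k == i') * m.-1.

Lemma expg_card_wrap (x : gT) p q :
  (x ^+ (1 + q + (p + m.-1)) = x ^+ (p + q))%g.
Proof.
have -> : 1 + q + (p + m.-1) = p + q + m.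
  by rewrite -[in RHS]card_prednK addnS addnA add1n !addSn (addnC q).
by rewrite expgD [X in (_ * X)%g]expg_dvd_card ?mulg1.
Qed.

Lemma sum_delta i n : i < n -> \sum_(k < n) (k == i :> nat) = 1.
Proof.
move=> lt_in; rewrite (bigD1 (Ordinal lt_in)) //= eqxx big1 // => k.
by rewrite -val_eqE /= => /negPf ->.
Qed.

Lemma dvdn_sum_dipole i i' n : i < n -> i' < n ->
  m %| \sum_(k < n) dipole i i' k.
Proof.
move=> lt_in lt_i'n; rewrite big_split /= -big_distrl /= !sum_delta //.
by rewrite mul1n add1n card_prednK.
Qed.

Lemma dipole0 i i' n : i < n -> i' < n -> dipole i i' n = 0.
Proof. by move=> *; rewrite /dipole !gtn_eqF. Qed.

Lemma grid_row i : grid_set (fun z => b ^+ (z.1 == i))%g.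
Proof.
exists i.+1, (fun k => (k == i) : nat), (fun=> 0), (fun _ _ => 0),
  (fun _ _ => 0).
split=> [n lt_in|]; last first.
  by apply/funext => z; rewrite /grid_word addn0 !mulg1.
by split; rewrite ?gtn_eqF // => *; rewrite !big1 // => *; rewrite big1.
Qed.

Lemma grid_col j : grid_set (fun z => b ^+ (z.2 == j))%g.
Proof.
exists j.+1, (fun=> 0), (fun k => (k == j) : nat), (fun _ _ => 0),
  (fun _ _ => 0).
split=> [n lt_jn|]; last first.
  by apply/funext => z; rewrite /grid_word !mulg1.
by split; rewrite ?gtn_eqF // => *; rewrite !big1 // => *; rewrite big1.
Qed.

Lemma grid_rect i i' j j' :
  grid_set (fun z => a ^+ (dipole i i' z.1 * dipole j j' z.2))%g.
Proof.
exists (maxn (maxn i i') (maxn j j')).+1, (fun=> 0), (fun=> 0),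
  (fun k l => dipole i i' k * dipole j j' l), (fun _ _ => 0).
split=> [n|]; last by apply/funext => z; rewrite /grid_word mul1g mulg1.
rewrite !gtn_max => /andP[/andP[ltin lti'n] /andP[ltjn ltj'n]].
split=> // => [k|k|l|].
- by rewrite !(@dipole0 _ _ n) // muln0.
- by rewrite -big_distrr dvdn_mull //= dvdn_sum_dipole.
- by rewrite -big_distrl dvdn_mulr //= dvdn_sum_dipole.
- by rewrite big1 // => *; rewrite big1.
Qed.

Lemma grid_diff i j :
  grid_set (fun z => c ^+ ((z == (0, 0)) + (z == (i, j)) * m.-1))%g.
Proof.
exists (maxn i j).+1, (fun=> 0), (fun=> 0), (fun _ _ => 0),
  (fun k l => ((k == 0) && (l == 0)) + ((k == i) && (l == j)) * m.-1).
split=> [n|]; last first.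
  by apply/funext => -[k l]; rewrite /grid_word !mul1g !xpair_eqE.
rewrite gtn_max => /andP[ltin ltjn].
have n_gt0 : 0 < n := leq_ltn_trans (leq0n i) ltin.
split=> // => [k|k|l|].
- by rewrite (gtn_eqF n_gt0) (gtn_eqF ltin) (gtn_eqF ltjn) !andbF.
- by rewrite big1.
- by rewrite big1.
have sum_delta2 p q : p < n -> q < n ->
    \sum_(k < n) \sum_(l < n) ((k == p :> nat) && (l == q :> nat)) = 1.
  move=> ltpn ltqn; rewrite -[RHS](sum_delta ltpn); apply: eq_bigr => k _.
  by case: eqP => _; rewrite ?sum_delta // big1.
under eq_bigr do rewrite big_split -big_distrl /=.
rewrite big_split -big_distrl /= !sum_delta2 //.
by rewrite mul1n add1n card_prednK.
Qed.

Definition row_elt i : grid_algebra := SigSub (mem_set (grid_row i)).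
Definition col_elt j : grid_algebra := SigSub (mem_set (grid_col j)).
Definition rect_elt i i' j j' : grid_algebra :=
  SigSub (mem_set (grid_rect i i' j j')).
Definition diff_elt i j : grid_algebra := SigSub (mem_set (grid_diff i j)).

Lemma diff_elt_far i z : z.1 < i ->
  val (diff_elt i 0) z = if z == (0, 0) then c else 1%g.
Proof.
case: z => p q /= lt_pi; rewrite [(p, q) == (i, 0)]xpair_eqE ltn_eqF //= addn0.
by case: ifP.
Qed.

(** * Homomorphisms from the grid algebra to a finite algebra *)

Section Hom.
Variables (N : algebra group_signature) (x : grid_algebra -> N).
Hypothesis xhom : is_hom x.

(** Both [d] and [d'] are values of one term in [v], [d] and a third argument, [w'] or [w], which
    [x] identifies. The term is expanded in the source, where the group laws hold. *)
Lemma hom_commutator_swap (d d' v w w' : grid_algebra) :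
  (forall z, val d' z = [~ val v z : gT, val w z : gT] * val d z)%g ->
  (forall z, [~ val v z : gT, val w' z : gT] = 1)%g ->
  x w = x w' -> x d = x d'.
Proof.
move=> dE vw' xw.
pose comm u := gmul (gmul (ginv v) (gmul (ginv u) (gmul v u))) d.
have -> : d = comm w'.
  by apply: val_inj; apply/funext => z; rewrite -[LHS]mul1g -(vw' z).
have -> : d' = comm w by apply: val_inj; apply/funext => z; rewrite dE.
by rewrite /comm !(hom_gmul xhom, hom_ginv xhom) xw.
Qed.

(** The commutator of the rectangle with row [i] is [c] at [(i, j)] and [c^-1] at [(i, j')]: it
    moves the [c^-1] of [diff_elt i j] to column [j']. *)
Lemma hom_row_const i i' j j' : i != i' -> x (row_elt i) = x (row_elt i') ->
  x (diff_elt i j) = x (diff_elt i j').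
Proof.
(* The opposite side of the rectangle lies in a third row, so that it avoids row [i']. *)
move=> ii' xw; pose i2 := (i + i').+1.
have ii2 : (i == i2) = false by rewrite ltn_eqF // ltnS leq_addr.
have i'i2 : (i' == i2) = false by rewrite ltn_eqF // ltnS leq_addl.
apply: (hom_commutator_swap (v := rect_elt i i2 j j') _ _ xw) => -[k l] /=.
  rewrite commXXg // -expgD /dipole !xpair_eqE.
  have [->|_] /= := eqVneq k i; last by rewrite muln0.
  rewrite ii2 mul1n muln1.
  have [_|_] /= := eqVneq l j; last by rewrite addnC addn0.
  by rewrite mul1n expg_card_wrap.
rewrite commXXg // /dipole; have [->|_] := eqVneq k i'; last by rewrite muln0.
by rewrite eq_sym (negPf ii') i'i2 !mul0n.
Qed.

Lemma hom_col_const i i' j j' : j != j' -> x (col_elt j) = x (col_elt j') ->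
  x (diff_elt i j) = x (diff_elt i' j).
Proof.
move=> jj' xw; pose j2 := (j + j').+1.
have jj2 : (j == j2) = false by rewrite ltn_eqF // ltnS leq_addr.
have j'j2 : (j' == j2) = false by rewrite ltn_eqF // ltnS leq_addl.
apply: (hom_commutator_swap (v := rect_elt i i' j j2) _ _ xw) => -[k l] /=.
  rewrite commXXg // -expgD /dipole !xpair_eqE.
  have [->|_] /= := eqVneq l j; last by rewrite !andbF muln0.
  rewrite jj2 !andbT addn0 !muln1.
  have [_|_] /= := eqVneq k i; last by rewrite addnC addn0.
  by rewrite mul1n expg_card_wrap.
rewrite commXXg // /dipole; have [->|_] := eqVneq l j'; last by rewrite muln0.
by rewrite (eq_sym j' j) (negPf jj') j'j2 !muln0.
Qed.

End Hom.

Lemma diff_elt_hom_bound (N : algebra group_signature) k (f : N -> 'I_k)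
    (x : grid_algebra -> N) : injective f -> is_hom x ->
  exists q, forall n, #|[set i : 'I_n | `[< x (diff_elt i 0) <> q >]]| <= k.
Proof.
move=> finj xhom.
have [j0 j0_good] : exists j, forall i i', x (diff_elt i j) = x (diff_elt i' j).
  apply: contrapT => /forallNP bad.
  (* If no column were constant, [k.+1] columns would have distinct images in [N]. *)
  have inj : injective (fun j : 'I_k.+1 => f (x (col_elt j))).
    move=> j j' /finj xj; apply/eqP/negPn/negP; rewrite -val_eqE => jj'.
    by apply: (bad j) => i i'; exact: hom_col_const xj.
  by have := leq_card _ inj; rewrite !card_ord ltnn.
exists (x (diff_elt 0 j0)) => n.
set S := [set _ | _].
(* Two rows with equal images are constant for [x], hence take the limit value at column [j0]; so
   exceptional rows have distinct images. *)
have inj : {in S &, injective (fun i : 'I_n => f (x (row_elt i)))}.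
  move=> i i' + _ /finj xw; rewrite inE => /asboolP xi.
  apply/eqP/negPn/negP; rewrite -val_eqE => ii'; apply: xi.
  by rewrite (hom_row_const xhom _ j0 ii' xw).
by rewrite -(card_in_imset inj) -[k in leqRHS]card_ord max_card.
Qed.

End Grid.

(** * The contradiction with duality *)

Lemma class2_inherently_nondualisable (gT : finGroupType) (a b : gT) :
  commute a [~ a, b]%g -> commute b [~ a, b]%g -> [~ a, b]%g != 1%g ->
  inherently_nondualisable (group_algebra gT).
Proof.
move=> cac cbc c1; split; first exact: finite_finset.
move=> N /finite_algebra_injection[k [f finj]] [ego dual] NG.
have := dual _ (ISP_subalgebra_power (grid_subuniverse cac cbc) NG).
move=> /(@duality_limit _ _ _ _ (fun i => diff_elt cac cbc i 0) k).
case=> [x xhom|y yP]; first exact: (diff_elt_hom_bound finj xhom).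
have [I [h [hhom hinj]]] := ISP_injective_hom NG.
case/negP: c1; apply/eqP.
apply: (grid_no_point cac (g := val y)) (set_valP y) => z.
apply: hinj; apply/funext => i; apply: contrapT => neq.
pose x (u : grid_algebra cac cbc) := h (val u z) i.
have xhom : is_hom x.
  by move=> s us; rewrite /x /= (hhom s).
(* The last [k.+1] indices all lie past [z.1], where [diff_elt] has reached its limit at [z]; if [y]
   differed there, all of them would be exceptions. *)
have := yP x xhom (z.1.+1 + k.+1); apply/negP; rewrite -ltnNge.
rewrite -[leqLHS]card_ord -(card_imset _ (@rshift_inj z.1.+1 k.+1)).
apply: subset_leq_card; apply/fintype.subsetP => _ /imsetP[l _ ->].
rewrite inE; apply/asboolP; rewrite /x diff_elt_far ?ltn_addr //.
exact: nesym.
Qed.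

Theorem theorem6p1 (gT : finGroupType) (G : {group gT}) :
  (exists (p : nat) (P : {group gT}),
     [/\ prime p, (p.-Sylow(G) P)%g & ~~ abelian P]) ->
  inherently_nondualisable (group_algebra (subg_of G)).
Proof.
move=> [p [P [_ sylP ncP]]].
have [a [b [Pa Pb c1 cac cbc]]] :=
  nilpotent_nonabelian_central_commutator (pgroup_nil (pHall_pgroup sylP)) ncP.
have sPG := fintype.subsetP (pHall_sub sylP).
have val_comm (u v : subg_of G) : sgval [~ u, v]%g = [~ sgval u, sgval v]%g.
  by [].
have subgR : subg G [~ a, b]%g = [~ subg G a, subg G b]%g.
  by apply: val_inj; rewrite [RHS]val_comm /= !subgK ?groupR ?sPG.
apply: (@class2_inherently_nondualisable _ (subg G a) (subg G b)).
- by rewrite /commute -subgR -!subgM ?groupR ?sPG // cac.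
- by rewrite /commute -subgR -!subgM ?groupR ?sPG // cbc.
- rewrite -subgR; apply: contraNneq c1 => /(congr1 sgval).
  by rewrite subgK ?groupR ?sPG // => ->.
Qed.
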